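(* Let $F\colon\mathbb{R}^m\to\mathbb{R}$ be an averaging operator and let $f\in L^\infty(\mathbb{T}_m,\mathbb{R})$ be such that there exist $\lambda\in(0,1)$ and $k\in\mathbb{R}_{>0}$ with $$|f(x)|\le k(1-\lambda)^{l(x)}\quad\text{for all } x\in\mathbb{T}_m.$$ If $u\in L^{\infty}_{loc}([0,+\infty);L^\infty(\mathbb{T}_m,\mathbb{R}))$ is the solution of $$\begin{cases} u_t(x,t)-\Delta_F u(x,t)=0 & \text{in } \mathbb{T}_m\times(0,+\infty),\\ u(x,0)=f(x) & \text{in } \mathbb{T}_m,\end{cases}$$ then $$\max_{x\in\mathbb{T}_m}|u(x,t)|\le k e^{-\lambda t}\quad\text{for all } t\in[0,+\infty).$$
   Context: Let $m\in\mathbb{N}$, $m>2$. $\mathbb{T}_m$ is the directed tree with regular $m$-branching: its vertices are the empty sequence $\emptyset$ and all finite sequences $(a_1,\dots,a_k)$, $k\in\mathbb{N}$, with $a_i\in\{0,1,\dots,m-1\}$. Each vertex $x$ has $m$ successors $(x,0),\dots,(x,m-1)$, obtained by appending one more coordinate to $x$. The level $l(x)$ of a vertex is its length as a sequence ($l(\emptyset)=0$). $L^\infty(\mathbb{T}_m,\mathbb{R})$ is the set of bounded functions $f\colon\mathbb{T}_m\to\mathbb{R}$. An averaging operator is a continuous function $F\colon\mathbb{R}^m\to\mathbb{R}$ such that: (i) $F(0,\dots,0)=0$ and $F(1,\dots,1)=1$; (ii) $F(tx_1,\dots,tx_m)=tF(x_1,\dots,x_m)$ for all $t\in\mathbb{R}$;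 (iii) $F(t+x_1,\dots,t+x_m)=t+F(x_1,\dots,x_m)$ for all $t\in\mathbb{R}$; (iv) $F(x_1,\dots,x_m)<\max\{x_1,\dots,x_m\}$ if not all $x_j$ are equal; (v) $F$ is nondecreasing with respect to each variable. $\Delta_F u(x,t)=F(u((x,0),t),\dots,u((x,m-1),t))-u(x,t)$. $L^{\infty}_{loc}([0,+\infty);L^\infty(\mathbb{T}_m,\mathbb{R}))$ is the set of functions $v$ on $\mathbb{T}_m\times[0,+\infty)$ (measurable in $t$) that are bounded on $\mathbb{T}_m\times[0,T]$ for every $T>0$. A solution of the Cauchy problem is a function $u$ such that, for each vertex $x$, $u(x,\cdot)$ is continuous on $[0,+\infty)$, differentiable on $(0,+\infty)$, satisfies the equation at every $t>0$, and $u(x,0)=f(x)$. For bounded $f$ the solution in this space exists and is unique. *)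

(* Defs.v *)
From HB Require Import structures.
From mathcomp Require Import all_boot all_order all_algebra.
From mathcomp Require Import all_classical all_reals all_analysis.
Set Implicit Arguments.
Unset Strict Implicit.
Unset Printing Implicit Defensive.
Import Order.TTheory GRing.Theory Num.Theory.
Import numFieldNormedType.Exports.
Local Open Scope classical_set_scope.
Local Open Scope ring_scope.

(* Vertices of the m-branching tree: finite sequences over {0, ..., m-1}; the
   root is [::], and the successors of x append one coordinate at the end. *)
Definition tree (m : nat) : Type := seq 'I_m.

Definition succ (m : nat) (x : tree m) (i : 'I_m) : tree m := rcons x i.

Definition level (m : nat) (x : tree m) : nat := size x.

Record averaging_operator (R : realType) (m : nat) (F : 'rV[R]_m -> R) : Prop :=
  AveragingOperator {
    averaging_continuous : continuous F;
    averaging_0 : F (const_mx 0) = 0;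
    averaging_1 : F (const_mx 1) = 1;
    averaging_scale : forall (t : R) (x : 'rV[R]_m), F (t *: x) = t * F x;
    averaging_shift : forall (t : R) (x : 'rV[R]_m),
      F (const_mx t + x) = t + F x;
    (* As the default value x 0 i of the big operator is itself an entry of x,
       the right-hand side is exactly max {x_1, ..., x_m}. *)
    averaging_lt_max : forall (x : 'rV[R]_m) (i j : 'I_m), x 0 i != x 0 j ->
      F x < \big[Num.max/x 0 i]_(l < m) x 0 l;
    averaging_nondecreasing : forall (x : 'rV[R]_m) (i : 'I_m) (s : R),
      x 0 i <= s -> F x <= F (\row_j (if j == i then s else x 0 j))
  }.

(* Functions on tree m * [0, +oo) are represented by functions on tree m and
   the whole of R, of which only the values at times t >= 0 are ever used. *)
Definition tree_laplacian (R : realType) (m : nat) (F : 'rV[R]_m -> R)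
    (u : tree m -> R -> R) (x : tree m) (t : R) : R :=
  F (\row_i u (succ x i) t) - u x t.

Definition Linfty (R : realType) (m : nat) (f : tree m -> R) : Prop :=
  [bounded f x | x in [set: tree m]].

Definition Linfty_loc (R : realType) (m : nat) (u : tree m -> R -> R) : Prop :=
  (forall x : tree m, measurable_fun (`[0, +oo[ : set R) (u x)) /\
  (forall T : R, 0 < T ->
    [bounded u p.1 p.2 | p in [set: tree m] `*` `[0, T]]).

Record cauchy_solution (R : realType) (m : nat) (F : 'rV[R]_m -> R)
    (f : tree m -> R) (u : tree m -> R -> R) : Prop := CauchySolution {
  cauchy_continuous : forall x : tree m, {within `[0, +oo[, continuous (u x)};
  cauchy_derivable : forall (x : tree m) (t : R), 0 < t -> derivable (u x) t 1;
  cauchy_equation : forall (x : tree m) (t : R), 0 < t ->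
    (u x)^`()%classic t - tree_laplacian F u x t = 0;
  cauchy_initial : forall x : tree m, u x 0 = f x
}.

(* Main.v *)
Require Import Defs.
From HB Require Import structures.
From mathcomp Require Import all_boot all_order all_algebra.
From mathcomp Require Import all_classical all_reals all_analysis.
From mathcomp Require Import ring lra.
Set Implicit Arguments.
Unset Strict Implicit.
Unset Printing Implicit Defensive.
Import Order.TTheory GRing.Theory Num.Theory.
Import numFieldNormedType.Exports.
Local Open Scope classical_set_scope.
Local Open Scope ring_scope.

(** For every real a, the function a (1 - lambda)^level(x) e^(- lambda t)
    solves the equation: it is constant on the successors of a vertex, where it
    is 1 - lambda times its value at the vertex, so its Laplacian is - lambda
    times itself ([separated_solution]). Taking a = k and a = - k gives two
    solutions which, by the decay hypothesis, enclose u at time 0, and the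
    comparison principle ([comparison_principle]) keeps u between them at all
    times:
      |u(x,t)| <= k (1 - lambda)^level(x) e^(- lambda t).
    The factor (1 - lambda)^level(x) is at most 1, which gives the bound, and it
    tends to 0 with the level; since each level is finite, |u(.,t)| therefore
    attains its maximum ([max_of_level_decay]).

    The comparison principle rests on a contraction. If the difference w = u - v
    of two solutions is at most c on [0, T], then by monotonicity and
    translation invariance of F the difference of the F-averages of u and v is
    at most c as well, so w' + w <= c; integrating with the factor e^t from
    w(.,0) <= 0 improves the bound to c (1 - e^(-t)). A positive supremum of w
    on [0, T] would thus be at most 1 - e^(-T) times itself, which is absurd.
    Since one factor 1 - e^(-T) < 1 is enough, T need not be small. *)

Lemma averaging_const (R : realType) (m : nat) (F : 'rV[R]_m -> R) (c : R) :
  averaging_operator F -> F (const_mx c) = c.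
Proof.
move=> hF.
by rewrite -[const_mx c]addr0 (averaging_shift hF) (averaging_0 hF) addr0.
Qed.

(** The axiom raises one coordinate at a time; passing from x to y takes m
    such steps. *)
Lemma averaging_monotone (R : realType) (m : nat) (F : 'rV[R]_m -> R)
    (x y : 'rV[R]_m) :
  averaging_operator F -> (forall i, x 0 i <= y 0 i) -> F x <= F y.
Proof.
move=> hF lexy.
(* z n agrees with y on the first n coordinates and with x on the others. *)
pose z n : 'rV[R]_m := \row_j (if (j < n)%N then y 0 j else x 0 j).
have -> : y = z m by apply/rowP => j; rewrite mxE ltn_ord.
have: (m <= m)%N by [].
elim: {-2}m => [_|n IHn lt_nm].
  have -> // : z 0%N = x.
  by apply/rowP => j; rewrite mxE.
apply: le_trans (IHn (ltnW lt_nm)) _.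
pose i := Ordinal lt_nm.
have -> : z n.+1 = \row_j (if j == i then y 0 i else z n 0 j).
  apply/rowP => j; rewrite !mxE ltnS leq_eqVlt -(inj_eq val_inj) /=.
  by case: eqP => [jn|//]; congr (y 0 _); apply/val_inj.
by apply: (averaging_nondecreasing hF); rewrite mxE ltnn.
Qed.

(** This one-sided Lipschitz estimate is the form in which monotonicity and
    translation invariance enter: F need not be linear, so the difference of
    two solutions does not solve the equation. *)
Lemma averaging_sub_le (R : realType) (m : nat) (F : 'rV[R]_m -> R)
    (x y : 'rV[R]_m) (c : R) :
  averaging_operator F -> (forall i, x 0 i - y 0 i <= c) -> F x - F y <= c.
Proof.
move=> hF lec; rewrite lerBlDr -(averaging_shift hF).
by apply: averaging_monotone => // i; rewrite !mxE -lerBlDr.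
Qed.

(** The function e^r (u - v - c) is nonincreasing: the equation turns its
    derivative into e^r times (the difference of the F-averages, minus c), and
    [averaging_sub_le] bounds that difference by c. It starts at most at - c. *)
Lemma solution_sub_contract (R : realType) (m : nat) (F : 'rV[R]_m -> R)
    (f g : tree m -> R) (u v : tree m -> R -> R) (T c : R) :
  averaging_operator F -> cauchy_solution F f u -> cauchy_solution F g v ->
  (forall x, f x <= g x) ->
  (forall x (s : R), 0 <= s <= T -> u x s - v x s <= c) ->
  forall x (s : R), 0 <= s <= T -> u x s - v x s <= c * (1 - expR (- s)).
Proof.
move=> hF su sv lefg lec x s /andP[s0 sT].
pose h r := expR r * (u x r - v x r - c).
have hder (r : R) : 0 < r ->
    is_derive r 1 h (expR r * (F (\row_i u (succ x i) r)
                               - F (\row_i v (succ x i) r) - c)).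
  move=> r0.
  have du := DeriveDef (cauchy_derivable su (x:=x) r0) erefl.
  have dv := DeriveDef (cauchy_derivable sv (x:=x) r0) erefl.
  apply: is_derive_eq.
  have := cauchy_equation su x r0; have := cauchy_equation sv x r0.
  rewrite /tree_laplacian !derive1E => /eqP + /eqP.
  rewrite !subr_eq !add0r => /eqP -> /eqP ->.
  by rewrite /GRing.scale /=; ring.
have hcont : {within `[0, s], continuous h}.
  have sub : ([set` `[0, s]] : set R) `<=` `[0, +oo[.
    by move=> r /=; rewrite !in_itv /= => /andP[-> _].
  have cu := continuous_subspaceW sub (cauchy_continuous su (x:=x)).
  have cv := continuous_subspaceW sub (cauchy_continuous sv (x:=x)).
  move=> r; apply: cvgM.
    exact: (continuous_subspaceT (@continuous_expR R)).
  by apply: cvgB; [apply: cvgB; [exact: cu|exact: cv]|exact: cvg_cst].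
have le_h : h s <= h 0.
  apply: (ler0_derive1_le_cc (a := 0) (b := s) _ _ hcont) => //.
  - by move=> r; rewrite in_itv /= => /andP[r0 _]; have [] := hder r r0.
  - move=> r; rewrite in_itv /= => /andP[r0 rs].
    have [_ dE] := hder r r0; rewrite derive1E dE.
    apply: mulr_ge0_le0; first exact: expR_ge0.
    rewrite subr_le0; apply: averaging_sub_le => // i; rewrite !mxE.
    by apply: lec; rewrite (ltW r0) (le_trans (ltW rs)).
  - by rewrite in_itv /= s0 lexx.
  - by rewrite in_itv /= s0 lexx.
have h0 : h 0 <= - c.
  rewrite /h expR0 mul1r (cauchy_initial su) (cauchy_initial sv).
  by have := lefg x; lra.
have := le_trans le_h h0; rewrite /h -ler_pdivlMl ?expR_gt0// -expRN.
by lra.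
Qed.

(** On an infinite tree u - v need not be bounded above; the bound c makes its
    supremum finite, so that the contraction can be applied to it. *)
Lemma comparison_principle (R : realType) (m : nat) (F : 'rV[R]_m -> R)
    (f g : tree m -> R) (u v : tree m -> R -> R) (T c : R) :
  averaging_operator F -> cauchy_solution F f u -> cauchy_solution F g v ->
  (forall x, f x <= g x) ->
  (forall x (s : R), 0 <= s <= T -> u x s - v x s <= c) ->
  forall x (s : R), 0 <= s <= T -> u x s <= v x s.
Proof.
move=> hF su sv lefg lec x s sT.
pose W := [set w | exists2 p : tree m * R,
  0 <= p.2 <= T & w = u p.1 p.2 - v p.1 p.2].
have supW : has_sup W.
  split; first by exists (u x s - v x s), (x, s).
  by exists c => _ [p pT ->]; exact: lec.
have leW y (r : R) : 0 <= r <= T -> u y r - v y r <= sup W.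
  by move=> rT; apply: sup_upper_bound => //; exists (y, r).
rewrite leNgt -subr_gt0; apply/negP => pos.
have supW0 : 0 < sup W by apply: lt_le_trans pos (leW _ _ sT).
have : sup W <= sup W * (1 - expR (- T)).
  apply: ge_sup; first by case: supW.
  move=> _ [[y r] /= rT ->].
  apply: le_trans (solution_sub_contract hF su sv lefg leW y rT) _.
  rewrite ler_pM2l// lerD2l lerN2 ler_expR lerN2.
  by case/andP: rT.
by rewrite ler_pMr// lerBrDr gerDl leNgt expR_gt0.
Qed.

(** The exponent of time matches that of the level because
    (1 - lambda) - 1 = - lambda. *)
Lemma separated_solution (R : realType) (m : nat) (F : 'rV[R]_m -> R)
    (lambda a : R) : averaging_operator F ->
  cauchy_solution F (fun x => a * (1 - lambda) ^+ level x)
    (fun x t => a * (1 - lambda) ^+ level x * expR (- lambda * t)).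
Proof.
move=> hF.
have der (b t : R) : is_derive t 1 (fun s => b * expR (- lambda * s))
    (- lambda * (b * expR (- lambda * t))).
  apply: is_derive_eq.
  by rewrite /GRing.scale /=; ring.
split.
- move=> x; apply: continuous_subspaceT => t.
  apply: differentiable_continuous; apply/derivable1_diffP.
  by have [] := der (a * (1 - lambda) ^+ level x) t.
- by move=> x t _; have [] := der (a * (1 - lambda) ^+ level x) t.
- move=> x t _; have [_ dE] := der (a * (1 - lambda) ^+ level x) t.
  rewrite derive1E dE /tree_laplacian.
  set r := \row_i _.
  have -> : r = const_mx ((1 - lambda) *
      (a * (1 - lambda) ^+ level x * expR (- lambda * t))).
    apply/rowP => i; rewrite !mxE /level /succ size_rcons exprS.
    by ring.
  by rewrite averaging_const//; ring.
- by move=> x; rewrite mulr0 expR0 mulr1.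
Qed.

(** If g is not identically 0, say g x1 <> 0, then |g| < |g x1| from some level
    N on, so that the maximum over the finitely many vertices of level at most N
    is global. *)
Lemma max_of_level_decay (R : realType) (m : nat) (g : tree m -> R)
    (q a : R) :
  `|q| < 1 -> (forall x, `|g x| <= a * q ^+ level x) ->
  exists x0, forall x, `|g x| <= `|g x0|.
Proof.
move=> q1 leg.
have [[x1 gx1]|g0] := pselect (exists x, 0 < `|g x|); last first.
  exists [::] => x; rewrite (le_trans _ (normr_ge0 _))// leNgt.
  by apply/negP => gx; apply: g0; exists x.
have lim0 : a * q ^+ n @[n --> \oo] --> (0 : R).
  by rewrite -[X in _ --> X](mulr0 a); apply: cvgMr; exact: cvg_expr.
have /(_ _ _ gx1) := cvgr_lt _ lim0.
case=> N _ small.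
have [y _ ymax] := Order.TotalTheory.arg_maxP
  (fun z : N.-bseq 'I_m => `|g z|) (erefl : xpredT (insub_bseq N [::])).
have near (x : tree m) : (size x <= N)%N -> `|g x| <= `|g y|.
  by move=> sx; have := ymax (Bseq sx) isT.
have farx (x : tree m) : (N <= size x)%N -> `|g x| < `|g x1|.
  by move=> sx; apply: le_lt_trans (leg x) _; exact: small.
have sx1 : (size x1 <= N)%N.
  by rewrite leqNgt; apply/negP => /ltnW /farx; rewrite ltxx.
exists y => x; have [/near//|/ltnW sx] := leqP (size x) N.
by apply: le_trans (near _ sx1); apply/ltW/farx.
Qed.

Theorem theorem1p4 (R : realType) (m : nat) (hm : (2 < m)%N)
    (F : 'rV[R]_m -> R) (hF : averaging_operator F)
    (f : tree m -> R) (hf : Linfty f)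
    (lambda k : R) (hlambda0 : 0 < lambda) (hlambda1 : lambda < 1)
    (hk : 0 < k)
    (hdecay : forall x : tree m, `|f x| <= k * (1 - lambda) ^+ level x)
    (u : tree m -> R -> R) (hu : Linfty_loc u) (hsol : cauchy_solution F f u)
    (t : R) (ht : 0 <= t) :
  exists x0 : tree m,
    (forall x : tree m, `|u x t| <= `|u x0 t|) /\
    `|u x0 t| <= k * expR (- lambda * t).
Proof.
have q0 : 0 <= 1 - lambda by lra.
have q1 : 1 - lambda < 1 by lra.
have barrier_ge0 (x : tree m) (s : R) :
    0 <= k * (1 - lambda) ^+ level x * expR (- lambda * s).
  by rewrite !mulr_ge0 ?expR_ge0 ?exprn_ge0// ltW.
(* Local boundedness is stated for positive horizons, whereas t may be 0. *)
have [M leM] : exists M, forall x (s : R), 0 <= s <= t -> `|u x s| <= M.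
  have t1 : 0 < t + 1 by rewrite ltr_wpDl.
  have [B [_ leB]] := hu.2 _ t1.
  exists (B + 1) => x s /andP[s0 st].
  apply: (leB (B + 1) _ (x, s)); first by rewrite ltrDl.
  by split => //=; rewrite in_itv /= s0 /= (le_trans st)// lerDl.
have leu (x : tree m) :
    `|u x t| <= k * (1 - lambda) ^+ level x * expR (- lambda * t).
  have tt : 0 <= t <= t by rewrite ht lexx.
  rewrite ler_norml -!mulNr; apply/andP; split.
  - apply: (comparison_principle (c := M) hF
      (separated_solution lambda (- k) hF) hsol _ _ _ tt) => [y|y s st].
      by have := hdecay y; rewrite ler_norml mulNr => /andP[].
    have barrier0 := barrier_ge0 y s.
    have := leM y s st; rewrite ler_norml => /andP[+ _].
    by rewrite !mulNr in barrier0 *; lra.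
  - apply: (comparison_principle (c := M) hF hsol
      (separated_solution lambda k hF) _ _ _ tt) => [y|y s st].
      by have := hdecay y; rewrite ler_norml => /andP[].
    have barrier0 := barrier_ge0 y s.
    have := leM y s st; rewrite ler_norml => /andP[_].
    by lra.
have [||x0 x0max] := @max_of_level_decay R m (u^~ t) (1 - lambda)
  (k * expR (- lambda * t)).
- by rewrite ger0_norm.
- by move=> x; rewrite mulrAC.
exists x0; split=> //.
apply: le_trans (leu x0) _; rewrite ler_wpM2r ?expR_ge0//.
by rewrite ler_piMr ?exprn_ile1 // ltW.
Qed.
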